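(* Let $\mathcal{D}$ be a finite Coxeter graph, and suppose that it is a tree all of whose labels are equal to $4$ except possibly one label, which can be any integer $k\ge 3$. Then there exists a finite regular hypertope with Coxeter diagram $\mathcal{D}$.
   Context: A Coxeter graph is a simple graph whose edges are labelled by elements of $\{3,4,\ldots\}\cup\{\infty\}$. An incidence system consists of a set of elements, a set $I$ of types, a symmetric reflexive incidence relation, and a type map to $I$ such that distinct incident elements have different types. A flag is a set of pairwise incident elements; a chamber is a flag with an element of every type; the system is an incidence geometry if every maximal flag is a chamber. A regular hypertope is an incidence geometry that is thin (every rank-one residue has exactly two elements), residually connected (every residue of rank at least two has connected incidence graph), and whose group of type-preserving automorphisms is flag-transitive (transitive on the flags of each given type set). It is finite if it has finitely many elements. Coxeter diagram. Fix a chamber of a regular hypertope with type set $I$. For each $i\in I$, the stabilizer in the type-preserving automorphism group of all elements of the chamber except the one of type $i$ is generated by an involution $\rho_i$; the $\rho_i$ generate the group. The Coxeter diagram of the hypertope is the labelled graph with vertex set $I$ in which the label between $i\ne j$ is the order of $\rho_i\rho_j$, edges with label $2$ being omitted. *)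

(* Defs.v *)
From mathcomp Require Import all_boot all_fingroup.

Set Implicit Arguments.
Unset Strict Implicit.
Unset Printing Implicit Defensive.

(* Labels lie in [option nat], with [None] standing for the label infinity.
   [cox_label] is meaningful only on pairs of adjacent vertices. *)
Record coxeter_graph (I : finType) := CoxeterGraph {
  cox_adj : rel I;
  cox_adj_sym : symmetric cox_adj;
  cox_adj_irr : irreflexive cox_adj;
  cox_label : I -> I -> option nat;
  cox_label_sym : forall i j, cox_adj i j -> cox_label i j = cox_label j i;
  cox_label_ge3 : forall i j m,
    cox_adj i j -> cox_label i j = Some m -> 3 <= m
}.

(* The bound on the size discards the degenerate cycles [:: x; y], which go
   back and forth along an edge. *)
Definition is_tree (I : finType) (D : coxeter_graph I) : Prop :=
  [/\ 0 < #|I|,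
      forall i j : I, connect (cox_adj D) i j
    & forall s : seq I, path.cycle (cox_adj D) s -> uniq s -> size s < 3].

Definition labels_4_except_one (I : finType) (D : coxeter_graph I) : Prop :=
  (forall i j, cox_adj D i j -> cox_label D i j = Some 4) \/
  (exists a b k,
     [/\ cox_adj D a b, 3 <= k, cox_label D a b = Some k
       & forall i j, cox_adj D i j -> [set i; j] != [set a; b] ->
           cox_label D i j = Some 4]).

(* The elements form a [finType]: all incidence systems below are finite. *)
Record incidence_system (I : finType) := IncidenceSystem {
  elt : finType;
  typ : elt -> I;
  inc : rel elt;
  inc_refl : reflexive inc;
  inc_sym : symmetric inc;
  inc_typ : forall x y, inc x y -> x != y -> typ x != typ y
}.

Section Hypertopes.

Variables (I : finType) (H : incidence_system I).
Implicit Types (F C : {set elt H}) (J : {set I}) (g : {perm (elt H)}).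

Definition is_flag F : bool := [forall x in F, forall y in F, inc x y].

Definition flag_type F : {set I} := [set typ x | x in F].

Definition is_chamber C : bool := is_flag C && (flag_type C == [set: I]).

Definition is_geometry : Prop := forall F, maxset is_flag F -> is_chamber F.

Definition residue F : {set elt H} :=
  [set x | (x \notin F) && [forall y in F, inc x y]].

Definition residue_rank F : nat := #|~: flag_type F|.

Definition is_thin : Prop :=
  forall F, is_flag F -> residue_rank F = 1 -> #|residue F| = 2.

(* Nonemptiness of these residues is automatic in an incidence geometry. *)
Definition is_residually_connected : Prop :=
  forall F, is_flag F -> 2 <= residue_rank F ->
    {in residue F &, forall x y,
       connect [rel u v | [&& u \in residue F, v \in residue F & inc u v]] x y}.

Definition type_auts : {set {perm (elt H)}} :=
  [set g : {perm (elt H)} | [forall x, typ (g x) == typ x]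
    & [forall x, forall y, inc (g x) (g y) == inc x y]].

Lemma type_auts_group_set : group_set type_auts.
Proof.
apply/group_setP; split=> [|g h].
  by rewrite inE; apply/andP; split; apply/forallP=> x;
    rewrite ?perm1 //; apply/forallP=> y; rewrite !perm1.
rewrite !inE => /andP[/forallP gt /forallP gi] /andP[/forallP ht /forallP hi].
apply/andP; split; apply/forallP=> x.
  by rewrite permM (eqP (ht _)) gt.
apply/forallP=> y; rewrite !permM (eqP (forallP (hi _) _)).
exact: (forallP (gi x) y).
Qed.

Canonical type_auts_group := Group type_auts_group_set.

(* For a geometry every set of flags below is nonempty, as [transitive _, on _]
   requires. *)
Definition is_flag_transitive : Prop :=
  forall J,
    [transitive type_auts, on [set F | is_flag F & flag_type F == J] | 'P^*].

Definition regular_hypertope : Prop :=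
  [/\ is_geometry, is_thin, is_residually_connected & is_flag_transitive].

Definition chamber_stab C (i : I) : {set {perm (elt H)}} :=
  ('C_type_auts([set x in C | typ x != i] | 'P))%g.

(* The involutions [rho i] are determined by C, and by flag-transitivity the
   orders below do not depend on the choice of the chamber C. *)
Definition has_coxeter_diagram (D : coxeter_graph I) : Prop :=
  exists C (rho : I -> {perm (elt H)}),
    [/\ is_chamber C,
        forall i, #[rho i]%g = 2 /\ chamber_stab C i = <[rho i]>%g
      & forall i j, i != j ->
          if cox_adj D i j then cox_label D i j = Some #[(rho i * rho j)%g]%g
          else #[(rho i * rho j)%g]%g = 2].

End Hypertopes.

(* Main.v *)
Require Import Defs.
From mathcomp Require Import all_boot all_fingroup ssralg zmodp cyclic.

(** The hypertope is grown along the tree, one leaf at a time, by Danzer's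
    cube construction.  Let H be a finite regular hypertope with type set S,
    let j be a type in S, and let V be the set of elements of type j.  Write
    V(x) for the elements of V incident to x.  The new hypertope has the
    subsets A of V as its elements of a new type u, and as its elements of
    type i in S the pairs formed of an element x of type i of H and a class
    of subsets of V modulo V(x); these are the faces of a cube with vertex
    set 2^V, the directions of a face being V(x).  Two elements are incident
    when their components in H are and the faces share a vertex.

    Faces are cosets of coordinate subspaces, which have the Helly property:
    faces that meet pairwise have a common vertex ([flag_common_vertex]).  So
    every flag is a flag of H placed at some vertex of the cube, and the
    properties of H pass to the cube.  The automorphisms of H and the
    translations of the cube together act transitively on the chambers, and
    only the identity fixes a chamber: an automorphism that does so fixes
    everything through one vertex because H has this property, and then
    everything through each neighbouring vertex by thinness ([cube_free]).
    The new involution is the translation t by the element v of type j in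
    the base chamber.  The lift of rho i fixes v when i differs from j, and
    then commutes with t; the lift of rho j moves v to another element, so
    the square of its product with t is a translation along two distinct
    coordinates, and the product has order 4.  The node u is thus joined to
    j alone, by an edge labelled 4 ([realizable_leaf]).

    The growth starts from the k-gon, which realizes the edge of arbitrary
    label k ([realizable_polygon]), or from two points of one type when all
    labels are 4 ([realizable_set1]).  A vertex outside a connected
    subset of a tree has at most one neighbour in it ([unique_neighbour]), so
    each enlargement of the subset by an adjacent vertex adds a leaf
    ([realizable_tree]). *)

Set Implicit Arguments.
Unset Strict Implicit.
Unset Printing Implicit Defensive.

(** * Preliminaries *)

(** Turning any function into a permutation, the identity by default, spares
    the definitions below a proof of injectivity inside their bodies. *)
Definition perm_of (T : finType) (f : T -> T) : {perm T} :=
  if @injectiveP T T f is ReflectT inj_f then perm inj_f else 1%g.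

Lemma perm_ofE (T : finType) (f : T -> T) : injective f -> perm_of f =1 f.
Proof.
move=> inj_f x; rewrite /perm_of.
by case: injectiveP => [h|/(_ inj_f)//]; rewrite permE.
Qed.

Lemma connect_homo (T T' : finType) (e : rel T) (e' : rel T') (f : T -> T') :
  {homo f : x y / e x y >-> e' x y} ->
  {homo f : x y / connect e x y >-> connect e' x y}.
Proof.
move=> fe x _ /connectP[p + ->]; elim: p x => [|y p IHp] x /=.
  by move=> _; apply: connect0.
by case/andP=> /fe/connect1 xy /IHp; apply: connect_trans.
Qed.

Section Flags.

Variables (I : finType) (H : incidence_system I).
Implicit Types (F B : {set elt H}) (g : {perm (elt H)}).

Lemma flagP F : reflect {in F &, forall x y, inc x y} (is_flag F).
Proof.
apply: (iffP forall_inP) => [h x y Fx Fy|h x Fx].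
  exact: (forall_inP (h x Fx)).
by apply/forall_inP => y; apply: h.
Qed.

Lemma residueP F x :
  reflect (x \notin F /\ {in F, forall y, inc x y}) (x \in residue F).
Proof.
rewrite inE; apply: (iffP andP) => -[nFx h]; split=> //.
  by move=> y; apply: (forall_inP h).
by apply/forall_inP.
Qed.

Lemma inc_typ_eq (x y : elt H) : inc x y -> typ x = typ y -> x = y.
Proof.
by move=> xy txy; apply/eqP/negPn/negP => /(inc_typ xy); rewrite txy eqxx.
Qed.

Lemma flagS F B : is_flag B -> F \subset B -> is_flag F.
Proof. by move/flagP=> h /subsetP s; apply/flagP=> x y /s ? /s; apply: h. Qed.

Lemma flagU1 F x :
  is_flag F -> {in F, forall y, inc x y} -> is_flag (x |: F).
Proof.
move=> /flagP fF h; apply/flagP=> y z /setU1P[->|Fy] /setU1P[->|Fz].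
- exact: inc_refl.
- exact: h.
- by rewrite inc_sym h.
- exact: fF.
Qed.

Lemma mem_flag_type F x : x \in F -> typ x \in flag_type F.
Proof. by move=> Fx; apply/imsetP; exists x. Qed.

Lemma residue_typ F x : x \in residue F -> typ x \notin flag_type F.
Proof.
case/residueP=> nFx h; apply/imsetP=> -[y Fy /(inc_typ_eq (h y Fy)) xy].
by rewrite xy Fy in nFx.
Qed.

(** Incident elements of one type are equal, so a subflag is determined by
    its type. *)
Lemma flag_eq_type B F1 F2 : is_flag B -> F1 \subset B -> F2 \subset B ->
  flag_type F1 = flag_type F2 -> F1 = F2.
Proof.
move=> /flagP fB s1 s2 e.
have sub (X Y : {set elt H}) : X \subset B -> Y \subset B ->
    flag_type X = flag_type Y -> X \subset Y.
  move=> /subsetP sX /subsetP sY eXY; apply/subsetP=> x Xx.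
  have /imsetP[y Yy exy] : typ x \in flag_type Y.
    by rewrite -eXY mem_flag_type.
  by rewrite (inc_typ_eq (fB _ _ (sX _ Xx) (sY _ Yy)) exy).
by apply/eqP; rewrite eqEsubset; apply/andP; split; apply: sub.
Qed.

Lemma autP g :
  reflect ((forall x, typ (g x) = typ x) /\
           (forall x y, inc (g x) (g y) = inc x y)) (g \in type_auts H).
Proof.
rewrite inE; apply: (iffP andP) => -[h1 h2]; split.
- by move=> x; apply/eqP/(forallP h1).
- by move=> x y; apply/eqP/(forallP (forallP h2 x)).
- by apply/forallP=> x; rewrite h1.
- by apply/forallP=> x; apply/forallP=> y; rewrite h2.
Qed.

Lemma aut_flag g F : g \in type_auts H -> is_flag F -> is_flag (g @: F).
Proof.
case/autP=> _ gi /flagP fF; apply/flagP=> _ _ /imsetP[x Fx ->] /imsetP[y Fy ->].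
by rewrite gi fF.
Qed.

Lemma aut_flag_type g F : g \in type_auts H -> flag_type (g @: F) = flag_type F.
Proof.
case/autP=> gt _; rewrite /flag_type -imset_comp; apply: eq_imset => x /=.
exact: gt.
Qed.

End Flags.

(** * Regular hypertopes whose types fill a subset *)

(** Allowing the types to fill only a subset [S] of [I] lets the type set grow
    while [I] stays fixed, so that no hypertope is ever transported to another
    type set.  Transitivity is asked on chambers only; with [reg_extend] it
    yields transitivity on the flags of every type.  The last condition says
    that the stabilizer of the base chamber is trivial. *)
Record regular_on (I : finType) (S : {set I}) (H : incidence_system I)
    (C : {set elt H}) : Prop := RegularOn {
  reg_typ : forall x : elt H, typ x \in S;
  reg_flag : is_flag C;
  reg_flag_type : flag_type C = S;
  reg_extend : forall F : {set elt H}, is_flag F ->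
    exists B, [/\ is_flag B, flag_type B = S & F \subset B];
  reg_thin : forall F : {set elt H}, is_flag F -> #|S :\: flag_type F| = 1 ->
    #|residue F| = 2;
  reg_connected : forall F : {set elt H}, is_flag F ->
    2 <= #|S :\: flag_type F| ->
    {in residue F &, forall x y, connect
       [rel v w | [&& v \in residue F, w \in residue F & inc v w]] x y};
  reg_trans : forall B, is_flag B -> flag_type B = S ->
    exists2 g, g \in type_auts H & B = g @: C;
  reg_free : forall g, g \in type_auts H -> {in C, forall x, g x = x} ->
    g = 1%g
}.

Definition diagram_on (I : finType) (D : coxeter_graph I) (S : {set I})
    (H : incidence_system I) (C : {set elt H})
    (rho : I -> {perm (elt H)}) : Prop :=
  [/\ forall i, i \in S -> [/\ rho i \in type_auts H, rho i != 1%g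
        & {in C, forall x, typ x != i -> rho i x = x}]
    & forall i j, i \in S -> j \in S -> i != j ->
        if cox_adj D i j then cox_label D i j = Some #[(rho i * rho j)%g]%g
        else #[(rho i * rho j)%g]%g = 2].

Definition realizable (I : finType) (D : coxeter_graph I) (S : {set I}) :=
  exists (H : incidence_system I) (C : {set elt H}) (rho : I -> {perm (elt H)}),
    regular_on S C /\ diagram_on D S C rho.

Section RegularOn.

Variables (I : finType) (S : {set I}) (H : incidence_system I).
Variables (C : {set elt H}) (regC : regular_on S C).
Implicit Types (g : {perm (elt H)}).

(** Chambers are conjugate to the base chamber, hence so are their stabilizers. *)
Lemma reg_free_any B g : is_flag B -> flag_type B = S -> g \in type_auts H ->
  {in B, forall x, g x = x} -> g = 1%g.
Proof.
move=> fB tB gA gB; have [a aA eB] := reg_trans regC fB tB.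
have /eqP : (a * g * a^-1)%g = 1%g.
  apply: (reg_free regC); first by rewrite !groupM ?groupV.
  move=> x Cx; rewrite !permM gB ?permK //; first by rewrite eB imset_f.
by rewrite -eq_mulgV1 -[X in _ == X]mulg1 (inj_eq (mulgI a)) => /eqP.
Qed.

(** An automorphism that fixes all elements of [C] but the one of type [i] is
    determined by the image of the latter, for which thinness leaves two
    choices; so the stabilizer has order at most 2. *)
Lemma stab_cyclic i rho : i \in S -> rho \in chamber_stab C i -> rho != 1%g ->
  #[rho]%g = 2 /\ chamber_stab C i = <[rho]>%g.
Proof.
move=> Si rhoS rho1.
have [fC tC] := (reg_flag regC, reg_flag_type regC).
have /imsetP[c Cc ic] : i \in flag_type C by rewrite tC.
have eqCx : [set x in C | typ x != i] = C :\ c.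
  apply/setP=> x; rewrite !inE andbC; case: (eqVneq x c) => [->|nxc] /=.
    by rewrite ic eqxx.
  case Cx: (x \in C); rewrite ?andbF // andbT ic.
  apply: contra_neq nxc => txc; apply: inc_typ_eq => //.
  exact: (flagP _ fC).
have fCc : is_flag (C :\ c) by apply: flagS fC (subsetDl _ _).
have tCc : S :\: flag_type (C :\ c) = [set i].
  apply/setP=> k; rewrite !inE; apply/andP/eqP => [[nk Sk]|->].
    move: Sk; rewrite -tC => /imsetP[x Cx kx]; rewrite kx ic.
    case: (eqVneq x c) => [->//|nxc].
    by case/negP: nk; rewrite kx mem_flag_type // !inE nxc.
  split=> //; apply/imsetP=> -[x /setD1P[nxc Cx] ix].
  case/eqP: nxc; apply: inc_typ_eq; first exact: (flagP _ fC).
  by rewrite -ix.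
have r2 : #|residue (C :\ c)| = 2 by apply: (reg_thin regC); rewrite ?tCc ?cards1.
have stabP g : g \in chamber_stab C i ->
    g \in type_auts H /\ {in C :\ c, forall x, g x = x}.
  rewrite /chamber_stab eqCx => /setIP[gA /astabP h]; split=> //.
have le2 : #|chamber_stab C i| <= 2.
  have inj : {in chamber_stab C i &, injective (fun g : {perm (elt H)} => g c)}.
    move=> g h gS hS /= egh; have [gA gC] := stabP g gS; have [hA hC] := stabP h hS.
    apply/eqP; rewrite eq_mulgV1; apply/eqP.
    apply: (reg_free regC); first by rewrite groupM ?groupV.
    move=> x Cx; rewrite permM; case: (eqVneq x c) => [->|nxc].
      by rewrite egh permK.
    by rewrite gC ?inE ?nxc //= -{1}(hC x) ?permK // !inE nxc.
  rewrite -r2 -(card_in_imset inj); apply/subset_leq_card/subsetP.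
  move=> _ /imsetP[g gS ->]; have [/autP[gt gi] gC] := stabP g gS.
  apply/residueP; split.
    rewrite !inE; apply/andP=> -[ngc Cgc]; case/eqP: ngc.
    by apply: inc_typ_eq; rewrite ?gt //; apply: (flagP _ fC).
  move=> y Cy; rewrite -(gC y Cy) gi.
  by apply: (flagP _ fC) => //; case/setD1P: Cy.
have sub : <[rho]>%g \subset chamber_stab C i.
  by rewrite /chamber_stab cycle_subG in rhoS *.
have ge2 : 2 <= #[rho]%g by rewrite ltn_neqAle eq_sym order_eq1 rho1 order_gt0.
have e : <[rho]>%g = chamber_stab C i.
  by apply/eqP; rewrite eqEcard sub (leq_trans le2).
split=> //; apply/eqP; rewrite eqn_leq ge2 andbT.
by rewrite orderE e.
Qed.

Lemma diagram_stab D rho i : diagram_on D S C rho -> i \in S ->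
  #[rho i]%g = 2 /\ chamber_stab C i = <[rho i]>%g.
Proof.
case=> rhoC _ Si; have [rA r1 rC] := rhoC i Si.
apply: stab_cyclic => //; rewrite inE rA; apply/astabP=> x.
by rewrite inE => /andP[Cx tx]; apply: rC.
Qed.

End RegularOn.

Lemma realizable_setT (I : finType) (D : coxeter_graph I) :
  realizable D [set: I] ->
  exists H : incidence_system I, regular_hypertope H /\ has_coxeter_diagram H D.
Proof.
case=> H [C [rho [regC dgm]]]; exists H; split; last first.
  exists C, rho; split.
  - by rewrite /is_chamber (reg_flag regC) (reg_flag_type regC) eqxx.
  - by move=> i; apply: (diagram_stab regC dgm); rewrite in_setT.
  - by move=> i j; case: dgm => _; apply; rewrite in_setT.
split.
- move=> F /maxsetP[fF maxF]; have [B [fB tB sFB]] := reg_extend regC fF.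
  by rewrite -(maxF B fB sFB) /is_chamber fB tB eqxx.
- by move=> F fF; rewrite /residue_rank -setTD; apply: (reg_thin regC).
- by move=> F fF; rewrite /residue_rank -setTD; apply: (reg_connected regC).
move=> J; pose F := [set x in C | typ x \in J].
have sF : F \subset C by apply/subsetP=> x; rewrite inE => /andP[].
have fF : is_flag F := flagS (reg_flag regC) sF.
have tF : flag_type F = J.
  apply/setP=> i; apply/imsetP/idP=> [[x]|Ji]; first by rewrite inE => /andP[_ ? ->].
  have /imsetP[x Cx ix] : i \in flag_type C by rewrite (reg_flag_type regC) in_setT.
  by exists x; rewrite // inE Cx -ix.
apply/imsetP; exists F; first by rewrite inE fF tF eqxx.
apply/setP=> F'; rewrite inE; apply/andP/orbitP => [[fF' /eqP tF']|[g gA <-]].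
  have [B [fB tB sB]] := reg_extend regC fF'.
  have [g gA eB] := reg_trans regC fB tB; exists g => //.
  rewrite /= setactE; apply: (flag_eq_type fB) => //; last first.
    by rewrite -[LHS](aut_flag_type _ gA) tF' in tF *.
  by rewrite eB imsetS.
by rewrite /= setactE (aut_flag gA) // [flag_type _](aut_flag_type _ gA) tF.
Qed.

(** * The cube over a hypertope *)

Section Cube.

Variables (I : finType) (H : incidence_system I) (u j : I).
Hypothesis typ_neq_u : forall x : elt H, typ x != u.
Implicit Types (o : option (elt H)) (v w x y : elt H) (A B F : {set elt H}).

(** The coordinates along which a face of direction [o] extends: [Some x] is
    the direction of a face lying over [x], and [None] that of a vertex of the
    cube.  Elements whose type is not [j] lie in the span of every face; this
    makes any subset of [elt H] a name for a vertex, in place of subsets of the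
    set of elements of type [j]. *)
Definition span o : {set elt H} :=
  [set v | (typ v != j) || oapp (inc v) false o].

(** A face is encoded by its direction and the only vertex on it that avoids
    the coordinates in its span, so that equal faces have equal codes. *)
Definition is_face (p : option (elt H) * {set elt H}) : bool :=
  [disjoint p.2 & span p.1].

Definition face : finType := {p | is_face p}.

Definition dir (p : face) : option (elt H) := (val p).1.
Definition corner (p : face) : {set elt H} := (val p).2.

Fact face_at_subproof o A : is_face (o, A :\: span o).
Proof. by rewrite /is_face disjoints_subset setDE subsetIr. Qed.

(** Removing the span from [A] normalizes the vertex. *)
Definition face_at o A : face := Sub (o, A :\: span o) (face_at_subproof o A).

Lemma dir_face_at o A : dir (face_at o A) = o. Proof. by []. Qed.

Lemma corner_face_at o A v :
  v \in corner (face_at o A) = (v \notin span o) && (v \in A).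
Proof. by rewrite inE. Qed.

Lemma corner_notin_span (p : face) v : v \in span (dir p) -> v \notin corner p.
Proof. by move=> pv; apply/negP=> /(disjointFr (valP p)); rewrite pv. Qed.

Lemma faceK (p : face) : face_at (dir p) (corner p) = p.
Proof.
apply: val_inj; case: p => -[o A] fA /=; congr pair; rewrite /corner /dir /=.
by apply/setDidPl.
Qed.

Lemma face_at_eqP o A B :
  face_at o A = face_at o B <->
  (forall v, v \notin span o -> (v \in A) = (v \in B)).
Proof.
split=> [e v nv|e]; first by move: (corner_face_at o A v); rewrite e corner_face_at nv.
by apply: val_inj; congr pair; apply/setP=> v; rewrite !inE;
  case nv: (_ || _) => //=; apply: e; rewrite inE nv.
Qed.

Definition otyp o : I := oapp (@typ I H) u o.

Definition oinc o o' : bool :=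
  if (o, o') is (Some x, Some y) then inc x y else true.

(** The second condition says that the faces share a vertex: a common vertex
    is free on both spans and prescribed by one face outside them. *)
Definition face_inc (p q : face) : bool :=
  oinc (dir p) (dir q) &&
  [forall v, [|| v \in span (dir p), v \in span (dir q)
               | (v \in corner p) == (v \in corner q)]].

Lemma face_incP o o' A B :
  reflect (oinc o o' /\ (forall v, v \notin span o -> v \notin span o' ->
                         (v \in A) = (v \in B)))
          (face_inc (face_at o A) (face_at o' B)).
Proof.
apply: (iffP andP) => -[oo' h]; split=> //.
  move=> v nv nv'; move/forallP/(_ v): h.
  by rewrite !corner_face_at !dir_face_at (negPf nv) (negPf nv') /= => /eqP.
apply/forallP=> v; rewrite !corner_face_at !dir_face_at.
case nv: (_ \in _) => //=; case nv': (_ \in _) => //=; apply/eqP.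
by apply: h; rewrite ?nv ?nv'.
Qed.

Lemma face_inc_corner (p q : face) v : face_inc p q ->
  v \notin span (dir p) -> v \notin span (dir q) ->
  (v \in corner p) = (v \in corner q).
Proof.
by move=> /andP[_ /forallP/(_ v)] + /negPf nv /negPf nv'; rewrite nv nv' => /eqP.
Qed.

Lemma face_inc_refl : reflexive face_inc.
Proof.
move=> p; rewrite -(faceK p); apply/face_incP; split=> //.
by case: (dir p) => //= x; apply: inc_refl.
Qed.

Lemma oinc_sym : symmetric oinc.
Proof. by case=> [x|] [y|] //; apply: inc_sym. Qed.

Lemma face_inc_sym : symmetric face_inc.
Proof.
suff h p q : face_inc p q -> face_inc q p by move=> p q; apply/idP/idP; apply: h.
rewrite -(faceK p) -(faceK q) => /face_incP[h e]; apply/face_incP.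
by rewrite oinc_sym; split=> // v ? ?; rewrite e.
Qed.

Lemma oinc_typ o o' : oinc o o' -> otyp o = otyp o' -> o = o'.
Proof.
case: o o' => [x|] [y|] //= xy; first by move/(inc_typ_eq xy) ->.
- by move/eqP; rewrite (negPf (typ_neq_u x)).
- by move/esym/eqP; rewrite (negPf (typ_neq_u y)).
Qed.

Lemma face_inc_typ (p q : face) :
  face_inc p q -> p != q -> otyp (dir p) != otyp (dir q).
Proof.
move=> pq; apply: contra_neq => /oinc_typ e.
have {e} e : dir p = dir q by case/andP: pq => /e.
move: pq; rewrite -(faceK p) -(faceK q) e => /face_incP[_ h].
by apply/face_at_eqP => v nv; apply: h.
Qed.

Definition cube : incidence_system I :=
  @IncidenceSystem I face (fun p => otyp (dir p)) face_inc
    face_inc_refl face_inc_sym face_inc_typ.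

Lemma span_None v : (v \in span None) = (typ v != j).
Proof. by rewrite inE orbF. Qed.

Lemma span_Some x v : (v \in span (Some x)) = (typ v != j) || inc v x.
Proof. by rewrite inE. Qed.

(** Different elements of type [j] are not incident. *)
Lemma vertex_notin_span v w : typ v = j ->
  w \notin span None -> w != v -> w \notin span (Some v).
Proof.
move=> jv; rewrite span_None span_Some negbK => /eqP jw; rewrite jw eqxx /=.
by apply: contra => /inc_typ_eq ->; rewrite ?jw.
Qed.

Lemma sub_span_None o : span None \subset span o.
Proof. by apply/subsetP=> v; rewrite span_None inE => ->. Qed.

Lemma inc_vertex (p : elt cube) A :
  inc p (face_at None A : elt cube) = (p == face_at (dir p) A).
Proof.
rewrite -[in LHS](faceK p) -[in RHS](faceK p) dir_face_at; apply/face_incP/eqP => [[_ h]|].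
  apply/face_at_eqP => v nv; apply: h => //.
  by apply: contra nv; apply: (subsetP (sub_span_None _)).
move/face_at_eqP=> h; split; first by case: (dir p).
by move=> v nv _; apply: h.
Qed.

Lemma inc_same_vertex o o' A :
  inc (face_at o A : elt cube) (face_at o' A) = oinc o o'.
Proof. by apply/face_incP/idP => [[]|]. Qed.

Lemma face_at_inj A : injective (face_at^~ A).
Proof. by move=> o o' /(congr1 dir). Qed.

(** Helly property.  The union of the normalized vertices works: a
    coordinate [v] outside the span of a face [p] that belongs to the
    normalized vertex of another face [q] lies outside the span of [q] too,
    so that [p] and [q] agree there. *)
Lemma flag_common_vertex (F : {set elt cube}) :
  is_flag F -> exists A, {in F, forall p, p = face_at (dir p) A}.
Proof.
move=> /flagP fF; exists (\bigcup_(p in F) corner p) => p Fp.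
rewrite -[LHS]faceK; apply/face_at_eqP=> v nv.
apply/idP/bigcupP=> [pv|[q Fq qv]]; first by exists p.
rewrite (face_inc_corner (fF _ _ Fp Fq)) //.
by apply: contraL qv; apply: corner_notin_span.
Qed.

(** What the flag [F] of the cube looks like in [H] when seen from [A]. *)
Definition base_flag A (F : {set elt cube}) : {set elt H} :=
  [set x | face_at (Some x) A \in F].

Lemma base_flag_flag A (F : {set elt cube}) :
  is_flag F -> is_flag (base_flag A F).
Proof.
move=> /flagP fF; apply/flagP=> x y; rewrite !inE => /fF h /h.
by rewrite inc_same_vertex.
Qed.

Lemma mem_base_flag A (F : {set elt cube}) x :
  x \in base_flag A F = (face_at (Some x) A \in F).
Proof. by rewrite inE. Qed.

Definition cone A F : {set elt cube} :=
  face_at None A |: [set face_at (Some x) A | x in F].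

Lemma cone_flag A F : is_flag F -> is_flag (cone A F).
Proof.
move=> /flagP fF; apply: flagU1.
  apply/flagP=> _ _ /imsetP[x Fx ->] /imsetP[y Fy ->].
  by rewrite inc_same_vertex; apply: fF.
by move=> _ /imsetP[x Fx ->]; rewrite inc_same_vertex.
Qed.

Lemma cone_flag_type A F : flag_type (cone A F) = u |: flag_type F.
Proof.
rewrite /cone /flag_type imsetU1; congr (_ |: _).
by rewrite -imset_comp.
Qed.

Lemma mem_cone A F p : p \in cone A F = (p == face_at (dir p) A) &&
  oapp (fun x => x \in F) true (dir p).
Proof.
rewrite !inE; apply/orP/andP=> [[/eqP->//|/imsetP[x Fx ->//]]|].
case=> /eqP ep h; case: (dir p) ep h => [x|] ep /= h; last by left; apply/eqP.
by right; apply/imsetP; exists x.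
Qed.

Lemma base_flag_type A (F : {set elt cube}) :
  {in F, forall p, p = face_at (dir p) A} ->
  flag_type (base_flag A F) = flag_type F :\ u.
Proof.
move=> FA; apply/setP=> i; rewrite in_setD1.
apply/imsetP/andP=> [[x]|[iu /imsetP[p Fp ip]]].
  rewrite inE => Fx ->; rewrite typ_neq_u; split=> //.
  by apply/imsetP; exists (face_at (Some x) A : elt cube).
have := FA p Fp; move: ip iu => ->; rewrite /=.
case ep: (dir p) => [x|] /= iu; last by rewrite eqxx in iu.
by move=> epA; exists x => //; rewrite inE -epA.
Qed.

Lemma vertex_of_type (p : elt cube) : (typ p == u) = (dir p == None).
Proof.
by rewrite /=; case: (dir p) => [x|] /=; rewrite ?(negPf (typ_neq_u x)) ?eqxx.
Qed.

Lemma cube_flagP (F : {set elt cube}) : is_flag F ->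
  exists A, [/\ {in F, forall p, p = face_at (dir p) A},
    is_flag (base_flag A F), flag_type (base_flag A F) = flag_type F :\ u
    & (face_at None A \in F) = (u \in flag_type F)].
Proof.
move=> fF; have [A FA] := flag_common_vertex fF; exists A; split=> //.
- exact: base_flag_flag.
- exact: base_flag_type.
apply/idP/imsetP=> [FN|[p Fp /esym/eqP]]; first by exists (face_at None A : elt cube).
by rewrite vertex_of_type => /eqP pN; rewrite -pN -FA.
Qed.

(** Around a vertex the cube looks like [H]. *)
Lemma residue_base A (F : {set elt cube}) x :
  {in F, forall p, p = face_at (dir p) A} ->
  (face_at (Some x) A \in residue F) = (x \in residue (base_flag A F)).
Proof.
move=> FA; apply/residueP/residueP; rewrite mem_base_flag => -[nx h]; split=> //.
  by move=> y; rewrite mem_base_flag => /h; rewrite inc_same_vertex.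
move=> p Fp; rewrite (FA p Fp) inc_same_vertex.
by case ep: (dir p) => [y|] //; apply: h; rewrite mem_base_flag -ep -FA.
Qed.

Lemma residue_through_vertex A (F : {set elt cube}) p :
  {in F, forall q, q = face_at (dir q) A} -> face_at None A \in F ->
  p \in residue F ->
  exists2 x, x \in residue (base_flag A F) & p = face_at (Some x) A.
Proof.
move=> FA FN Rp; have [nFp incp] := residueP _ _ Rp.
have pA : p = face_at (dir p) A by apply/eqP; rewrite -inc_vertex; apply: incp.
case ep: (dir p) pA => [x|] pA; last by rewrite pA FN in nFp.
by exists x => //; rewrite -(residue_base _ FA) -pA.
Qed.

Definition symdiff A B : {set elt H} := [set v | (v \in A) (+) (v \in B)].

Lemma in_symdiff A B v : (v \in symdiff A B) = (v \in A) (+) (v \in B).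
Proof. exact: in_set. Qed.

(** Translation of the cube [2^V], as a group of exponent 2, by [A]; it changes
    no direction. *)
Definition translate A : {perm (elt cube)} :=
  perm_of (fun p : elt cube => face_at (dir p) (symdiff A (corner p)) : elt cube).

Lemma translateE A o B : translate A (face_at o B) = face_at o (symdiff A B).
Proof.
have E o' B' : face_at o' (symdiff A (corner (face_at o' B'))) = face_at o' (symdiff A B').
  by apply/face_at_eqP => v nv; rewrite !in_symdiff !corner_face_at nv.
rewrite /translate perm_ofE ?E //.
apply: inv_inj => p; rewrite /= E -[RHS]faceK; apply/face_at_eqP => v _.
by rewrite !in_symdiff addKb.
Qed.

Lemma translate_aut A : translate A \in type_auts cube.
Proof.
apply/autP; split=> [p|p q]; first by rewrite -(faceK p) translateE.
rewrite -(faceK p) -(faceK q) !translateE.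
apply/face_incP/face_incP => -[oo h]; split=> // v nv nv'.
  by move: (h v nv nv'); rewrite !in_symdiff => /addbI.
by rewrite !in_symdiff h.
Qed.

Lemma translateD A B : (translate A * translate B)%g = translate (symdiff A B).
Proof.
apply/permP=> p; rewrite permM -(faceK p) !translateE; apply/face_at_eqP => v _.
by rewrite !in_symdiff addbCA addbA.
Qed.

Lemma translate_eq1 A : translate A = 1%g <-> A \subset span None.
Proof.
split=> [E|/subsetP sA]; last first.
  apply/permP=> p; rewrite perm1 -(faceK p) translateE; apply/face_at_eqP => v nv.
  rewrite in_symdiff; case Av: (v \in A) => //; case/negP: nv.
  exact: (subsetP (sub_span_None _)) (sA _ Av).
apply/subsetP=> v Av; apply/negPn/negP => nv.
have := congr1 (fun g : {perm (elt cube)} => g (face_at None set0)) E.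
rewrite translateE perm1 => /face_at_eqP/(_ v nv).
by rewrite !in_symdiff Av in_set0.
Qed.

(** An automorphism of [H] permutes the coordinates of the cube. *)
Definition lift (g : {perm (elt H)}) : {perm (elt cube)} :=
  perm_of (fun p : elt cube => face_at (omap g (dir p)) (g @: corner p) : elt cube).

Lemma mem_span_omap (g : {perm (elt H)}) v o : g \in type_auts H ->
  (g v \in span (omap g o)) = (v \in span o).
Proof.
by case/autP=> gt gi; rewrite !inE gt; case: o => //= x; rewrite gi.
Qed.

Lemma face_at_aut_eqP (g : {perm (elt H)}) o A B : g \in type_auts H ->
  face_at (omap g o) (g @: A) = face_at (omap g o) B <->
  (forall v, v \notin span o -> (v \in A) = (g v \in B)).
Proof.
move=> gA; split=> [/face_at_eqP h v nv|h].
  by rewrite -(mem_imset A v (@perm_inj _ g)) h // mem_span_omap.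
apply/face_at_eqP => v; rewrite -[v](permKV g) mem_span_omap // => nv.
by rewrite mem_imset ?h //; apply: perm_inj.
Qed.

Lemma liftE g o A : g \in type_auts H ->
  lift g (face_at o A) = face_at (omap g o) (g @: A).
Proof.
move=> gA; rewrite /lift perm_ofE.
  apply/face_at_aut_eqP => // v nv.
  by rewrite corner_face_at nv mem_imset //; apply: perm_inj.
move=> p q /= E; have Edir : dir p = dir q.
  by move/(congr1 dir): E; rewrite !dir_face_at; apply/inj_omap/perm_inj.
rewrite -(faceK p) -(faceK q) Edir; apply/face_at_eqP => v nv.
move: E; rewrite Edir => /(face_at_aut_eqP _ _ _ gA)/(_ v nv) ->.
by rewrite mem_imset //; apply: perm_inj.
Qed.

Lemma lift_aut g : g \in type_auts H -> lift g \in type_auts cube.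
Proof.
move=> gA; have [gt gi] := autP _ gA; apply/autP; split=> [p|p q].
  by rewrite -(faceK p) liftE //=; case: (dir p).
rewrite -(faceK p) -(faceK q) !liftE //.
have E : oinc (omap g (dir p)) (omap g (dir q)) = oinc (dir p) (dir q).
  by case: (dir p) (dir q) => [x|] [y|] //; apply: gi.
apply/face_incP/face_incP; rewrite E => -[oo h]; split=> // v.
  move=> nv nv'; have := h (g v); rewrite !mem_span_omap // => /(_ nv nv').
  by rewrite !mem_imset //; apply: perm_inj.
rewrite -[v](permKV g) !mem_span_omap // => nv nv'.
by rewrite !mem_imset ?h //; apply: perm_inj.
Qed.

Lemma liftM : {in type_auts H &, {morph lift : g h / (g * h)%g}}.
Proof.
move=> g h gA hA; apply/permP=> p; rewrite permM -(faceK p) !liftE ?groupM //.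
rewrite -imset_comp.
have -> : omap (g * h)%g (dir p) = omap h (omap g (dir p)).
  by case: (dir p) => //= x; rewrite permM.
by congr face_at; apply: eq_imset => x; rewrite /= permM.
Qed.

Canonical lift_morphism := Morphism liftM.

Lemma lift_injm : ('injm lift)%g.
Proof.
apply/subsetP=> g /morphpreP[gA /set1P E]; apply/set1P/permP=> x.
have := congr1 (fun h : {perm (elt cube)} => dir (h (face_at (Some x) set0))) E.
by rewrite liftE // !perm1 !dir_face_at /= => -[].
Qed.

(** The automorphism group is a wreath product: automorphisms of [H] normalize
    the translations. *)
Lemma translate_lift A g : g \in type_auts H ->
  (translate A * lift g)%g = (lift g * translate (g @: A))%g.
Proof.
move=> gA; apply/permP=> p; rewrite !permM -(faceK p) translateE !liftE //.
rewrite translateE; apply/face_at_aut_eqP => // v nv.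
by rewrite !in_symdiff !mem_imset //; apply: perm_inj.
Qed.

Section Regular.

Variables (S : {set I}) (C : {set elt H}).
Hypotheses (regC : regular_on S C) (Su : u \notin S) (Sj : j \in S).

Lemma cube_missing_types (F : {set elt cube}) A :
  {in F, forall p, p = face_at (dir p) A} ->
  is_flag F -> (u |: S) :\: flag_type F =
  (if u \in flag_type F then set0 else [set u]) :|: S :\: flag_type (base_flag A F).
Proof.
move=> FA fF; rewrite (base_flag_type FA); apply/setP=> i; rewrite !inE.
have [->|niu] /= := eqVneq i u.
  by rewrite (negPf Su) orbF andbT; case: ifP; rewrite !inE ?eqxx.
by case: ifP; rewrite !inE ?(negPf niu).
Qed.

Lemma cube_typ (p : elt cube) : typ p \in u |: S.
Proof.
by rewrite inE /=; case: (dir p) => [x|] /=; rewrite ?in_set1 ?eqxx // (reg_typ regC) orbT.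
Qed.

Lemma cube_extend (F : {set elt cube}) : is_flag F ->
  exists B : {set elt cube}, [/\ is_flag B, flag_type B = u |: S & F \subset B].
Proof.
move=> fF; have [A [FA fb _ _]] := cube_flagP fF.
have [B [fB tB sB]] := reg_extend regC fb.
exists (cone A B); split; [exact: cone_flag | by rewrite cone_flag_type tB | ].
apply/subsetP=> p Fp; rewrite mem_cone -(FA p Fp) eqxx /=.
case ep: (dir p) => [x|] //=; apply: (subsetP sB).
by rewrite mem_base_flag -ep -FA.
Qed.

Definition flip v A : {set elt H} := [set w | (w \in A) (+) (w == v)].

Lemma flip_agree v A o : v \in span o -> face_at o (flip v A) = face_at o A.
Proof.
move=> ov; apply/face_at_eqP=> w ow; rewrite inE.
by case: eqP ow => [->|_]; rewrite ?ov ?addbF.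
Qed.

(** If only the new type is missing from the flag, the flag contains an
    element [v] of type [j], and the faces of the flag meet exactly in the two
    vertices that differ at [v].  Otherwise the flag contains a vertex, and its
    residue is one in [H]. *)
Lemma cube_thin (F : {set elt cube}) : is_flag F ->
  #|(u |: S) :\: flag_type F| = 1 -> #|residue F| = 2.
Proof.
move=> fF; have [A [FA fb tb FN]] := cube_flagP fF; rewrite (cube_missing_types FA fF).
case: ifP => uF.
  rewrite set0U => /(reg_thin regC fb) <-.
  rewrite -(card_imset _ (inj_comp (@face_at_inj A) (@Some_inj _))).
  congr #|pred_of_set _|; apply/setP=> p; apply/idP/imsetP=> [|[x Rx ->]].
    by apply: residue_through_vertex => //; rewrite FN.
  by rewrite /= residue_base.
rewrite cardsU1 inE (negPf Su) andbF add1n => -[/eqP].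
rewrite cards_eq0 setD_eq0 => sS.
have /imsetP[v bv jv] : j \in flag_type (base_flag A F) by apply: (subsetP sS).
have FNone p : p \in F -> dir p != None.
  by move=> Fp; apply: contraFneq uF => pN; rewrite -FN -pN -FA.
have bspan p : p \in F -> v \in span (dir p).
  move=> Fp; have := FNone p Fp; case ep: (dir p) => [x|] // _.
  rewrite span_Some (flagP _ fb) ?orbT //.
  by rewrite mem_base_flag -ep -FA.
have -> : residue F = [set (face_at None A : elt cube); face_at None (flip v A)].
  apply/setP=> p; rewrite in_set2; apply/idP/orP=> [Rp|].
    have pN : dir p = None.
      apply/eqP; rewrite -vertex_of_type; have := residue_typ Rp.
      apply: contraNT => pu; have : typ p \in flag_type (base_flag A F).
        apply: (subsetP sS); have := cube_typ p.
        by rewrite in_setU1 (negPf pu).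
      by rewrite tb in_setD1 => /andP[].
    have : inc p (face_at (Some v) A : elt cube).
      by case/residueP: Rp => _; apply; rewrite -mem_base_flag.
    rewrite -(faceK p) pN => /face_incP[_ h].
    have [vp|vp] := boolP ((v \in corner p) == (v \in A)); [left|right];
      apply/eqP/face_at_eqP => w nw.
      have [->|wv] := eqVneq w v; first exact/eqP.
      by apply: h => //; apply: vertex_notin_span.
    have [->|wv] := eqVneq w v.
      by rewrite inE eqxx addbT; case: (v \in corner p) vp; case: (v \in A).
    by rewrite inE (negPf wv) addbF; apply: h => //; apply: vertex_notin_span.
  move=> h; apply/residueP; split.
    by apply/negP=> /FNone; case: h => /eqP ->.
  move=> q Fq; rewrite inc_sym; case: h => /eqP ->; rewrite inc_vertex.
    by rewrite -FA.
  by rewrite flip_agree ?bspan -?FA.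
rewrite cards2; case: eqP => // /face_at_eqP/(_ v).
rewrite span_None -jv eqxx inE eqxx addbT => /(_ isT).
by case: (v \in A).
Qed.

(** The residue of a flag through a vertex is one in [H].  In the residue of a
    flag [F] without vertex, each face lies next to a vertex, and two
    vertices of the residue differ only in coordinates [v] common to all
    spans of [F].  These can be changed one by one: a face of direction [y] in
    the residue with [v] in its span contains the vertex before and after
    the change. *)
Lemma cube_connected (F : {set elt cube}) : is_flag F ->
  2 <= #|(u |: S) :\: flag_type F| ->
  {in residue F &, forall p q, connect
     [rel r s | [&& r \in residue F, s \in residue F & inc r s]] p q}.
Proof.
move=> fF; have [A [FA fb tb FN]] := cube_flagP fF; rewrite (cube_missing_types FA fF).
set e := [rel v w | _].
have eE p q :
    rel_of_simpl e p q = [&& p \in residue F, q \in residue F & inc p q] by [].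
case: ifP => uF.
  rewrite set0U => /(reg_connected regC fb) cb p q.
  have toA r : r \in residue F ->
      exists2 x, x \in residue (base_flag A F) & r = face_at (Some x) A.
    by apply: residue_through_vertex => //; rewrite FN.
  move=> /toA[x Rx ->] /toA[y Ry ->].
  apply: (connect_homo (f := fun x => face_at (Some x) A)) (cb x y Rx Ry).
  move=> a b /and3P[Ra Rb ab].
  by rewrite eE !(residue_base _ FA) Ra Rb inc_same_vertex.
rewrite cardsU1 inE (negPf Su) andbF add1n ltnS => S1.
have FNone p : p \in F -> dir p != None.
  by move=> Fp; apply: contraFneq uF => pN; rewrite -FN -pN -FA.
have resN B : {in F, forall p, p = face_at (dir p) B} ->
    face_at None B \in residue F.
  move=> FB; apply/residueP; split; first by apply/negP=> /FNone.
  by move=> p Fp; rewrite inc_sym inc_vertex -FB.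
have e_sym : connect_sym e.
  by apply: sym_connect_sym => a b; rewrite !eE inc_sym andbCA.
have toN p : p \in residue F -> exists2 B, connect e p (face_at None B) &
    {in F, forall p, p = face_at (dir p) B}.
  move=> Rp; have fU : is_flag (p |: F).
    by case/residueP: (Rp) => _ h; apply: flagU1.
  have [B UB] := flag_common_vertex fU; exists B.
    apply: connect1; rewrite eE Rp resN; last by move=> q Fq; apply: UB; rewrite setU1r.
    by rewrite inc_vertex; apply/eqP/UB; rewrite setU11.
  by move=> q Fq; apply: UB; rewrite setU1r.
have step v B : typ v = j -> {in F, forall p, v \in span (dir p)} ->
    {in F, forall p, p = face_at (dir p) B} ->
    connect e (face_at None B) (face_at None (flip v B)).
  move=> jv Fv FB; have fbB := base_flag_flag B fF.
  have vb : {in base_flag B F, forall x, inc v x}.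
    by move=> x; rewrite mem_base_flag => /Fv; rewrite span_Some jv eqxx.
  have [y Ry vy] : exists2 y, y \in residue (base_flag B F) & inc v y.
    have [bv|bv] := boolP (v \in base_flag B F); last first.
      by exists v; [apply/residueP | apply: inc_refl].
    (* [v] already lies in the flag; as two types are missing from [F], some
       old type is, and a chamber of [H] provides a face of that type. *)
    have [i] : exists i, i \in S :\: flag_type (base_flag A F).
      by apply/card_gt0P.
    rewrite tb -(base_flag_type FB) => /setDP[Si bi].
    have [G [fG tG sG]] := reg_extend regC fbB.
    have /imsetP[y Gy iy] : i \in flag_type G by rewrite tG.
    exists y; last by apply: (flagP _ fG) => //; apply: (subsetP sG).
    apply/residueP; split; first by apply: contra bi => by_; rewrite iy mem_flag_type.
    by move=> z bz; apply: (flagP _ fG) => //; apply: (subsetP sG).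
  have RyB : face_at (Some y) B \in residue F by rewrite residue_base.
  have FB' : {in F, forall p, p = face_at (dir p) (flip v B)}.
    by move=> p Fp; rewrite flip_agree ?Fv -?FB.
  apply: (@connect_trans _ _ (face_at (Some y) B)); apply: connect1.
    by rewrite eE RyB resN // inc_same_vertex.
  rewrite eE RyB resN // -(@flip_agree v); first by rewrite inc_same_vertex.
  by rewrite span_Some vy orbT.
(* [n] is the number of coordinates at which [A] and [B] differ. *)
have conn n B : #|[set v | (typ v == j) && ((v \in A) (+) (v \in B))]| = n ->
    {in F, forall p, p = face_at (dir p) B} ->
    connect e (face_at None B) (face_at None A).
  elim: n B => [|n IHn] B.
    move/eqP; rewrite cards_eq0 => /eqP/setP h _.
    suff -> : face_at None B = face_at None A by apply: connect0.
    apply/face_at_eqP=> v; rewrite span_None negbK => jv.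
    by move: (h v); rewrite !inE jv /=; case: (v \in A); case: (v \in B).
  set D := [set v | _] => cD FB.
  have [v Dv] : exists v, v \in D by apply/card_gt0P; rewrite cD.
  have := Dv; rewrite inE => /andP[/eqP jv ABv].
  have Fv : {in F, forall p, v \in span (dir p)}.
    move=> p Fp; apply/negPn/negP => nv.
    have /face_at_eqP/(_ v nv) E : face_at (dir p) A = face_at (dir p) B.
      by rewrite -FA -?FB.
    by rewrite E addbb in ABv.
  apply: (connect_trans (step v B jv Fv FB)); apply: IHn.
    have <- : #|D :\ v| = n by apply/eqP; rewrite -eqSS -cD (cardsD1 v D) Dv.
    congr #|pred_of_set _|; apply/setP=> w; rewrite !inE addbA.
    case: (eqVneq w v) => [->|_] /=; last by rewrite addbF.
    by rewrite ABv andbF.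
  by move=> p Fp; rewrite flip_agree ?Fv -?FB.
move=> p q /toN[B1 pB1 FB1] /toN[B2 qB2 FB2].
apply: connect_trans pB1 _; rewrite e_sym; apply: connect_trans qB2 _.
apply: (connect_trans (conn _ B2 erefl FB2)); rewrite e_sym.
exact: (conn _ B1 erefl FB1).
Qed.

Lemma symdiff0 A : symdiff A set0 = A.
Proof. by apply/setP=> v; rewrite in_symdiff in_set0 addbF. Qed.

(** First move the flag of [H], then the vertex. *)
Lemma cube_trans (B : {set elt cube}) : is_flag B -> flag_type B = u |: S ->
  exists2 g, g \in type_auts cube & B = g @: cone set0 C.
Proof.
move=> fB tB; have [A [BA fb tb BN]] := cube_flagP fB.
have tbS : flag_type (base_flag A B) = S by rewrite tb tB setU1K.
have [g gA eb] := reg_trans regC fb tbS.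
have g'A : (lift g * translate A)%g \in type_auts cube.
  by rewrite groupM ?lift_aut ?translate_aut.
exists (lift g * translate A)%g => //; symmetry.
apply: (flag_eq_type fB) => //; last first.
  by rewrite (aut_flag_type _ g'A) cone_flag_type (reg_flag_type regC) tB.
apply/subsetP=> _ /imsetP[p pC ->].
have gE o : (lift g * translate A)%g (face_at o set0) = face_at (omap g o) A.
  by rewrite permM liftE // translateE imset0 symdiff0.
case/setU1P: pC => [->|/imsetP[x Cx ->]]; rewrite gE.
  by rewrite [omap _ _]/= BN tB setU11.
by rewrite -mem_base_flag eb imset_f.
Qed.

(** An automorphism fixing the vertex [A] acts on the faces through [A], which
    form a copy of [H]; there it fixes a chamber, hence everything. *)
Lemma fix_vertex_flag (g : {perm (elt cube)}) A B : g \in type_auts cube ->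
  is_flag B -> flag_type B = S -> {in cone A B, forall p, g p = p} ->
  forall o, g (face_at o A) = face_at o A.
Proof.
move=> gA fB tB gB; have [gt gi] := autP _ gA.
have gN : g (face_at None A) = face_at None A by rewrite gB ?setU11.
have gd o : g (face_at o A) = face_at (dir (g (face_at o A))) A.
  by apply/eqP; rewrite -inc_vertex -[X in inc _ X]gN gi inc_same_vertex; case: o.
pose h x := odflt x (dir (g (face_at (Some x) A))).
have hE x : g (face_at (Some x) A) = face_at (Some (h x)) A.
  rewrite gd; congr face_at; rewrite /h.
  have : otyp (dir (g (face_at (Some x) A))) = typ x := gt _.
  case: (dir _) => [//|] /= /esym/eqP.
  by rewrite (negPf (typ_neq_u x)).
have h_inj : injective h.
  move=> x y xy; have : g (face_at (Some x) A) = g (face_at (Some y) A).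
    by rewrite !hE xy.
  by move/perm_inj/face_at_inj => -[].
have hA : perm h_inj \in type_auts H.
  apply/autP; split=> [x|x y]; rewrite !permE.
    by have := gt (face_at (Some x) A); rewrite hE.
  by have := gi (face_at (Some x) A) (face_at (Some y) A); rewrite !hE !inc_same_vertex.
have h1 : perm h_inj = 1%g.
  apply: (reg_free_any regC fB tB hA) => x Bx; rewrite permE.
  have : g (face_at (Some x) A) = face_at (Some x) A.
    by apply: gB; apply/setU1r/imsetP; exists x.
  by rewrite hE => /face_at_inj[].
case=> [x|//]; rewrite hE; congr (face_at (Some _) A).
by have := congr1 (fun f : {perm _} => f x) h1; rewrite permE perm1.
Qed.

(** Induction on the size of the vertex [A].  If all faces through [A :\ v] are
    fixed, take a chamber of [H] through [v]: its faces through [A] also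
    contain [A :\ v], hence are fixed, and [A] is the only other vertex on the
    face of direction [v].  So [A] is fixed together with a chamber through
    it. *)
Lemma cube_free g : g \in type_auts cube ->
  {in cone set0 C, forall p, g p = p} -> g = 1%g.
Proof.
move=> gA gC; have [gt gi] := autP _ gA.
have fC := reg_flag regC; have tC := reg_flag_type regC.
suff gE A o : g (face_at o A) = face_at o A.
  by apply/permP=> p; rewrite perm1 -(faceK p).
move: {2}#|A| (erefl #|A|) o => n; elim: n A => [|n IHn] A cA.
  move/eqP: cA; rewrite cards_eq0 => /eqP ->.
  exact: (fix_vertex_flag gA fC tC gC).
have [v Av] : exists v, v \in A by apply/card_gt0P; rewrite cA.
have {}IHn : forall o, g (face_at o (A :\ v)) = face_at o (A :\ v).
  by apply: IHn; apply/eqP; rewrite -eqSS -cA (cardsD1 v A) Av.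
have eA o : v \in span o -> face_at o A = face_at o (A :\ v).
  move=> ov; apply/face_at_eqP=> w ow; rewrite !inE.
  by case: (eqVneq w v) ow => // ->; rewrite ov.
have [jv|jv] := boolP (v \in span None).
  by move=> o; rewrite eA ?IHn //; apply: (subsetP (sub_span_None _)).
have fv : is_flag [set v].
  by apply/flagP=> x y /set1P-> /set1P->; apply: inc_refl.
have [B [fB tB]] := reg_extend regC fv; rewrite sub1set => Bv.
have spanB x : x \in B -> v \in span (Some x).
  by move=> Bx; rewrite span_Some (flagP _ fB) ?orbT.
have gB x : x \in B -> g (face_at (Some x) A) = face_at (Some x) A.
  by move=> Bx; rewrite eA ?IHn ?spanB.
apply: (fix_vertex_flag gA fB tB) => p /setU1P[->|/imsetP[x Bx ->]]; last exact: gB.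
have dgN : dir (g (face_at None A)) = None.
  by apply/eqP; rewrite -vertex_of_type gt vertex_of_type.
have : inc (g (face_at None A)) (face_at (Some v) A : elt cube).
  by rewrite -[X in inc _ X]gB // gi inc_same_vertex.
rewrite -[g _]faceK dgN => /face_incP[_ h].
apply/face_at_eqP => w nw.
have vj : typ v = j by move: jv; rewrite span_None negbK => /eqP.
have [->|wv] := eqVneq w v; last by apply: h => //; apply: vertex_notin_span.
rewrite Av; apply: contraTT isT => /negPf nov.
have /face_at_eqP/(_ v jv) : face_at None A = face_at None (A :\ v).
  apply: (@perm_inj _ g); rewrite IHn -[LHS]faceK dgN.
  apply/face_at_eqP => z nz; rewrite in_setD1.
  have [->|zv] //= := eqVneq z v.
  by apply: h => //; apply: vertex_notin_span.
by rewrite Av setD11.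
Qed.

Lemma cube_regular : regular_on (u |: S) (cone set0 C).
Proof.
split.
- exact: cube_typ.
- exact/cone_flag/(reg_flag regC).
- by rewrite cone_flag_type (reg_flag_type regC).
- exact: cube_extend.
- exact: cube_thin.
- exact: cube_connected.
- exact: cube_trans.
- exact: cube_free.
Qed.

Lemma translate_sqr A : (translate A ^+ 2)%g = 1%g.
Proof.
rewrite expgS expg1 translateD; apply/translate_eq1.
by apply/subsetP=> v; rewrite in_symdiff addbb.
Qed.

Variables (D : coxeter_graph I) (rho : I -> {perm (elt H)}).
Hypothesis rhoD : diagram_on D S C rho.
Hypotheses (adj_uj : cox_adj D u j) (label_uj : cox_label D u j = Some 4).
Hypothesis adj_u : forall i, i \in S -> cox_adj D u i -> i = j.

Variable v : elt H.
Hypotheses (Cv : v \in C) (typ_v : typ v = j).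

Let t := translate [set v].

(** With [r] the lift of [rho i], the square of [t * r] is the translation by
    [[set v]] plus [[set rho i v]], which is trivial exactly if [rho i] fixes
    [v]; and it does unless [i] is [j], the type of [v]. *)
Lemma diagram_leaf i : i \in S ->
  if cox_adj D u i then cox_label D u i = Some #[(t * lift (rho i))%g]%g
  else #[(t * lift (rho i))%g]%g = 2.
Proof.
move=> Si; have [rhoC _] := rhoD; have [rA r1 rC] := rhoC i Si.
have [ri2 _] := diagram_stab regC rhoD Si.
have r2 : (lift (rho i) * lift (rho i))%g = 1%g.
  rewrite -liftM // -{2}[rho i]expg1 -expgS -ri2 expg_order.
  exact: (morph1 lift_morphism).
have span_v : v \notin span None by rewrite span_None typ_v eqxx.
have tr : (t * lift (rho i))%g = (lift (rho i) * translate [set rho i v])%g.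
  by rewrite translate_lift // imset_set1.
have trtr : ((t * lift (rho i)) ^+ 2)%g = translate (symdiff [set v] [set rho i v]).
  by rewrite expgS expg1 {2}tr mulgA -(mulgA t) r2 mulg1 translateD.
have [ij|ij] := eqVneq i j; last first.
  rewrite ifN; last by apply: contra ij => /(adj_u Si)/eqP.
  apply: nt_prime_order => //.
    rewrite trtr rC ?typ_v 1?eq_sym //; apply/translate_eq1.
    by apply/subsetP=> w; rewrite in_symdiff addbb.
  apply/eqP => /(congr1 (fun g : {perm (elt cube)} => g (face_at None set0))).
  rewrite permM translateE liftE // perm1 symdiff0 imset_set1.
  rewrite rC ?typ_v 1?eq_sym // => /face_at_eqP/(_ v span_v).
  by rewrite set11 in_set0.
subst i; rewrite adj_uj label_uj; congr Some; symmetry.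
apply: (@orderXprime _ 2 2) => //; apply: nt_prime_order => //.
  by rewrite trtr translate_sqr.
rewrite trtr; apply/eqP => /translate_eq1/subsetP/(_ v).
rewrite (negPf span_v) in_symdiff set11 in_set1; case: eqVneq => [rv|_]; last by move=> /(_ isT).
move=> _; case/eqP: r1; apply: (reg_free regC rA) => x Cx.
have [xj|xj] := eqVneq (typ x) j; last exact: rC.
have -> : x = v.
  by apply: inc_typ_eq; [apply: (flagP _ (reg_flag regC)) | rewrite xj].
by rewrite -rv.
Qed.

Definition cube_rho i : {perm (elt cube)} := if i == u then t else lift (rho i).

Lemma cube_diagram : diagram_on D (u |: S) (cone set0 C) cube_rho.
Proof.
have [rhoC rho_order] := rhoD.
have lift_rA i : i \in S -> rho i \in type_auts H.
  by move=> Si; case: (rhoC i Si).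
have orderC (x y : {perm (elt cube)}) : #[x]%g = 2 -> #[y]%g = 2 ->
    #[(x * y)%g]%g = #[(y * x)%g]%g.
  move=> x2 y2; rewrite -orderV invMg.
  have invE (z : {perm (elt cube)}) : #[z]%g = 2 -> z^-1%g = z.
    by move=> z2; apply/eqP; rewrite eq_invg_mul -{2}[z]expg1 -expgS -z2 expg_order.
  by rewrite !invE.
have t2 : #[t]%g = 2.
  apply: nt_prime_order => //; first exact: translate_sqr.
  apply/eqP => /translate_eq1/subsetP/(_ v).
  by rewrite span_None typ_v eqxx set11 => /(_ isT).
have r2 i : i \in S -> #[lift (rho i)]%g = 2.
  move=> Si; have [ri2 _] := diagram_stab regC rhoD Si.
  by rewrite -[RHS]ri2; apply: (order_injm lift_injm); apply: lift_rA.
split=> [i|i l].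
  rewrite /cube_rho in_setU1; case: eqVneq => [-> _|iu /= Si].
    split; first exact: translate_aut.
      by rewrite -order_eq1 t2.
    move=> p /setU1P[->|/imsetP[x Cx ->]]; first by rewrite /= eqxx.
    move=> _; rewrite translateE; apply/face_at_eqP=> w.
    rewrite in_symdiff in_set1; case: (eqVneq w v) => // ->.
    by rewrite span_Some (flagP _ (reg_flag regC)) ?orbT.
  have [rA r1 rC] := rhoC i Si.
  split; [exact: lift_aut | by rewrite -order_eq1 r2 |].
  move=> p /setU1P[->|/imsetP[x Cx ->]]; rewrite liftE // imset0 //.
  by move=> xi; rewrite /= rC.
rewrite /cube_rho !in_setU1; case: (eqVneq i u) => [->|iu] /=;
  case: (eqVneq l u) => [->|lu] //=; rewrite ?eqxx //.
- by move=> _ Sl _; apply: diagram_leaf.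
- move=> Si _ _; rewrite orderC ?r2 // cox_adj_sym.
  have := diagram_leaf Si; case: ifP => // ui.
  by rewrite (cox_label_sym ui).
move=> Si Sl il; rewrite -liftM ?lift_rA //.
rewrite (order_injm lift_injm) ?groupM ?lift_rA //.
exact: rho_order.
Qed.

End Regular.
End Cube.

Lemma realizable_leaf (I : finType) (D : coxeter_graph I) (S : {set I}) u j :
  u \notin S -> j \in S -> cox_adj D u j -> cox_label D u j = Some 4 ->
  {in S, forall i, cox_adj D u i -> i = j} ->
  realizable D S -> realizable D (u |: S).
Proof.
move=> Su Sj adj_uj label_uj adj_u [H [C [rho [regC rhoD]]]].
have typ_neq_u (x : elt H) : typ x != u.
  by apply: contraNneq Su => <-; apply: (reg_typ regC).
have /imsetP[v Cv jv] : j \in flag_type C by rewrite (reg_flag_type regC).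
exists (cube j typ_neq_u), (cone j typ_neq_u set0 C),
  (cube_rho j typ_neq_u rho v); split.
  exact: cube_regular.
by apply: (@cube_diagram _ _ _ j typ_neq_u S C regC) => //.
Qed.

(** * The starting hypertopes *)

Section PointPair.

Variables (I : finType) (i : I).

Fact point_pair_typ (x y : bool) : x == y -> x != y -> i != i.
Proof. by move=> ->. Qed.

Definition point_pair : incidence_system I :=
  @IncidenceSystem I bool (fun _ => i) (fun x y => x == y) (@eqxx _) (@eq_sym _)
    point_pair_typ.

Lemma point_pair_flag (F : {set elt point_pair}) :
  is_flag F -> F = set0 \/ exists x, F = [set x].
Proof.
move=> /flagP fF; have [->|[x Fx]] := set_0Vmem F; first by left.
right; exists x; apply/setP=> y; rewrite in_set1; apply/idP/eqP=> [Fy|->//].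
exact/eqP/(fF y x).
Qed.

Lemma point_pair_regular : @regular_on I [set i] point_pair [set true].
Proof.
have flag1 (x : elt point_pair) : is_flag [set x].
  by apply/flagP=> y z /set1P-> /set1P->; apply: inc_refl.
have type1 (x : elt point_pair) : flag_type [set x] = [set i] by apply: imset_set1.
have type0 : flag_type (set0 : {set elt point_pair}) = set0 by apply: imset0.
split=> //.
- by move=> x; rewrite in_set1.
- move=> F /point_pair_flag[->|[x ->]]; first by exists [set true]; rewrite sub0set.
  by exists [set x].
- move=> F /point_pair_flag[->|[x ->]]; last by rewrite type1 setDv cards0.
  move=> _; rewrite -[RHS]card_bool -cardsT; congr #|pred_of_set _|.
  by apply/setP=> x; rewrite in_setT; apply/residueP; split=> [|y]; rewrite in_set0.
- move=> F _; rewrite leqNgt => /negP[]; rewrite ltnS.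
  by rewrite (leq_trans (subset_leq_card (subsetDl _ _))) ?cards1.
- move=> B /point_pair_flag[->|[x ->]]; first by rewrite type0 => /setP/(_ i); rewrite in_set0 set11.
  move=> _; exists (tperm true x : {perm (elt point_pair)}); last by rewrite imset_set1 tpermL.
  by apply/autP; split=> // y z; apply: (inj_eq (@perm_inj _ _)).
- move=> g _ /(_ true (set11 _)) g1; apply/permP=> -[]; rewrite perm1 //.
  by case gf: (g false) => //; have /perm_inj : g false = g true by rewrite gf g1.
Qed.

Lemma realizable_set1 (D : coxeter_graph I) : realizable D [set i].
Proof.
exists point_pair, [set true], (fun _ => tperm true false : {perm (elt point_pair)}).
split; first exact: point_pair_regular.
split=> [l /set1P->|l l' /set1P-> /set1P->]; last by rewrite eqxx.
split=> [||x _]; last by rewrite eqxx.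
  by apply/autP; split=> // y z; apply: (inj_eq (@perm_inj _ _)).
by apply/eqP=> /permP/(_ true); rewrite tpermL perm1.
Qed.

End PointPair.

Section Polygon.

Import GRing.Theory.
Local Open Scope ring_scope.

Variables (I : finType) (a b : I) (k : nat).
Hypotheses (ab : a != b) (k_ge3 : (3 <= k)%N).

Let Z := 'Z_(k.*2).

Let m_gt1 : (1 < k.*2)%N.
Proof. by rewrite -double0 ltn_Sdouble; apply: leq_trans k_ge3. Qed.

Let natr_eq0 n : (n%:R == 0 :> Z) = (k.*2 %| n)%N.
Proof. by rewrite -val_eqE /= val_Zp_nat // /dvdn. Qed.

Let odd_add (x y : Z) : odd (x + y)%R = odd x (+) odd y.
Proof. by rewrite /= odd_mod ?oddD // -[_.+2]/((Zp_trunc _).+2) Zp_cast ?odd_double. Qed.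

Let odd1 : odd (1%R : Z).
Proof. by rewrite (val_Zp_nat m_gt1 1 : (1%R : Z) = _ :> nat) modn_small. Qed.

Let odd_opp (x : Z) : odd (- x)%R = odd x.
Proof.
have := odd_add (- x) x; rewrite addNr /=.
by case: (odd x); case: (odd _).
Qed.

(** The [k]-gon: vertices and edges are listed alternately around its boundary
    by the integers modulo [2k], even numbers for the vertices.  Two
    different elements are incident if and only if their numbers differ by
    1. *)
Definition polygon_typ (x : Z) : I := if odd x then b else a.

Definition polygon_inc (x y : Z) : bool := [|| y == x, y == x + 1 | x == y + 1].

Fact polygon_inc_refl : reflexive polygon_inc.
Proof. by move=> x; rewrite /polygon_inc eqxx. Qed.

Fact polygon_inc_sym : symmetric polygon_inc.
Proof.
by move=> x y; rewrite /polygon_inc eq_sym; congr (_ || _); apply: orbC.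
Qed.

Fact polygon_typS x : polygon_typ (x + 1) != polygon_typ x.
Proof. by rewrite /polygon_typ odd_add odd1; case: odd; rewrite // eq_sym. Qed.

Fact polygon_inc_typ x y :
  polygon_inc x y -> x != y -> polygon_typ x != polygon_typ y.
Proof.
case/or3P=> /eqP-> xy; [by rewrite eqxx in xy | | exact: polygon_typS].
by rewrite eq_sym polygon_typS.
Qed.

Definition polygon : incidence_system I :=
  IncidenceSystem polygon_inc_refl polygon_inc_sym polygon_inc_typ.

(** A vertex and an edge on it, or an edge and its other end: the chambers. *)
Definition side (x : elt polygon) : {set elt polygon} := [set x; (x : Z) + 1].

Lemma side_flag x : is_flag (side x).
Proof.
apply/flagP=> y z; rewrite !in_set2.
by move=> /orP[]/eqP-> /orP[]/eqP->; rewrite /= /polygon_inc eqxx ?orbT.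
Qed.

Lemma side_type x : flag_type (side x) = [set a; b].
Proof.
rewrite /flag_type /side imsetU1 imset_set1 /= /polygon_typ odd_add odd1.
by case: odd => //=; apply: setUC.
Qed.

Lemma polygon_flag (F : {set elt polygon}) : is_flag F ->
  [\/ F = set0, exists x, F = [set x] | exists x, F = side x].
Proof.
move=> fF; have [->|[x Fx]] := set_0Vmem F; first by constructor 1.
have [Fx0|[y /setD1P[yx Fy]]] := set_0Vmem (F :\ x).
  by constructor 2; exists x; rewrite -(setD1K Fx) Fx0 setU0.
constructor 3.
have [z Fz Fz1] : exists2 z : Z, z \in F & z + 1 \in F.
  have /or3P[/eqP yx'|/eqP yx'|/eqP xy] : polygon_inc x y by apply: (flagP _ fF).
  - by rewrite yx' eqxx in yx.
  - by exists x; rewrite -?yx'.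
  - by exists y; rewrite -?xy.
exists z; apply: (flag_eq_type fF) => //.
  by apply/subsetP=> w /set2P[]->.
apply/eqP; rewrite eqEsubset; apply/andP; split.
  apply/subsetP=> _ /imsetP[w _ ->]; rewrite side_type in_set2 /= /polygon_typ.
  by case: ifP; rewrite eqxx ?orbT.
by apply/imsetS/subsetP=> w /set2P[]->.
Qed.

(** The two cases are those of the rotations, which keep the orientation, and
    of the reflections, which reverse it. *)
Let polygon_aut (f : Z -> Z) (g : {perm (elt polygon)}) : g =1 f ->
  (forall x, odd (f x) = odd x) ->
  (forall x, f (x + 1) = f x + 1) \/ (forall x, f x = f (x + 1) + 1) ->
  g \in type_auts polygon.
Proof.
move=> gf fo f1; have gI : injective f by move=> x y; rewrite -!gf; apply: perm_inj.
apply/autP; split=> [x|x y]; rewrite !gf /=; first by rewrite /polygon_typ fo.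
rewrite /polygon_inc (inj_eq gI); congr (_ || _).
case: f1 => f1; first by rewrite -!f1 !(inj_eq gI).
have E z w : (f w == f z + 1) = (z == w + 1).
  by rewrite [f w]f1 (inj_eq (addIr _)) (inj_eq gI) eq_sym.
by rewrite !E orbC.
Qed.

Definition rotation (c : Z) : {perm (elt polygon)} := perm (@addIr Z c).

Lemma rotationE c (x : Z) : rotation c x = x + c.
Proof. by rewrite permE. Qed.

Lemma rotation_aut (c : Z) : ~~ odd c -> rotation c \in type_auts polygon.
Proof.
move=> c2; apply: (polygon_aut (f := fun x => x + c)).
- exact: rotationE.
- by move=> x; rewrite odd_add (negPf c2) addbF.
- by left=> x; rewrite addrAC.
Qed.

Definition reflection (c : Z) : {perm (elt polygon)} := perm (@subrI Z c).

Lemma reflectionE c (x : Z) : reflection c x = c - x.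
Proof. by rewrite permE. Qed.

Lemma reflection_aut (c : Z) : ~~ odd c -> reflection c \in type_auts polygon.
Proof.
move=> c2; apply: (polygon_aut (f := fun x => c - x)).
- exact: reflectionE.
- by move=> x; rewrite odd_add odd_opp (negPf c2).
- by right=> x; rewrite opprD addrA subrK.
Qed.

Lemma reflectionM c d : (reflection c * reflection d)%g = rotation (d - c).
Proof.
apply/permP=> x; rewrite permM !reflectionE rotationE.
by rewrite opprB addrA addrAC addrC addrA.
Qed.

Lemma polygon_regular : regular_on [set a; b] (side 0).
Proof.
have type0 : flag_type (set0 : {set elt polygon}) = set0 by apply: imset0.
have flag1 (x : elt polygon) : is_flag [set x].
  by apply/flagP=> y z /set1P-> /set1P->; apply: inc_refl.
have mem_typ (x : elt polygon) : typ x \in [set a; b].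
  by rewrite in_set2 /= /polygon_typ; case: ifP; rewrite eqxx ?orbT.
split=> //.
- exact: side_flag.
- exact: side_type.
- move=> F /polygon_flag[->|[x ->]|[x ->]].
  + by exists (side 0); rewrite side_flag side_type sub0set.
  + by exists (side x); rewrite side_flag side_type sub1set set21.
  + by exists (side x); rewrite side_flag side_type.
- move=> F /polygon_flag[->|[x ->]|[x ->]].
  + by rewrite type0 setD0 cards2 ab.
  + move=> _; have -> : residue [set x] = [set (x : Z) + 1; (x : Z) - 1].
      apply/setP=> y; apply/residueP/set2P=> [[]|].
        rewrite in_set1 => yx /(_ x (set11 x)) /or3P[|/eqP ->|/eqP ->].
        * by rewrite eq_sym (negPf yx).
        * by right; rewrite addrK.
        * by left.
      have one0 : (1 : Z) != 0 by rewrite oner_eq0.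
      case=> ->; (split; last by move=> _ /set1P->;
        rewrite /= /polygon_inc ?subrK eqxx !orbT).
        by rewrite in_set1 -subr_eq0 addrAC subrr add0r.
      by rewrite in_set1 -subr_eq0 addrAC subrr add0r oppr_eq0.
    rewrite cards2 (inj_eq (addrI _)) -addr_eq0 -[1 + 1]/(2%:R) natr_eq0.
    by rewrite gtnNdvd // -[2%N]/(1.*2)%N ltn_double; apply: ltnW.
  + by rewrite side_type setDv cards0.
- move=> F /polygon_flag[->|[x ->]|[x ->]].
  + move=> _ x y _ _; set e := [rel _ _ | _].
    have res z : z \in residue (set0 : {set elt polygon}).
      by apply/residueP; split=> [|w]; rewrite in_set0.
    have xn n : connect e x ((x : Z) + n%:R).
      elim: n => [|n IHn]; first by rewrite addr0 connect0.
      apply: (connect_trans IHn); apply: connect1.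
      by rewrite /= !res /= /polygon_inc -addrA -mulrSr eqxx orbT.
    by have := xn (y - x : Z); rewrite natr_Zp addrC subrK.
  + rewrite /flag_type imset_set1 => h; have := cardsD1 (typ x) [set a; b].
    by rewrite mem_typ cards2 ab add1n => /eqP; rewrite eqSS => /eqP e; rewrite -e in h.
  + by rewrite side_type setDv cards0.
- move=> B /polygon_flag[->|[x ->]|[x ->]].
  + by rewrite type0 => /setP/(_ a); rewrite set21 in_set0.
  + rewrite /flag_type imset_set1 => e; have := cards2 a b.
    by rewrite -e cards1 ab.
  + move=> _; case ox: (odd (x : Z)).
      exists (reflection ((x : Z) + 1)).
        by apply: reflection_aut; rewrite odd_add ox odd1.
      by rewrite /side imsetU1 imset_set1 !reflectionE subr0 add0r addrK setUC.
    exists (rotation x); first by apply: rotation_aut; rewrite ox.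
    by rewrite /side imsetU1 imset_set1 !rotationE add0r add0r addrC.
- move=> g /autP[_ gi] gC; have g0 : g (0 : Z) = (0 : Z) by rewrite gC ?set21.
  have g1 : g (1 : Z) = (1 : Z) by rewrite gC // /side add0r set22.
  suff gn n : g (n%:R : Z) = (n%:R : Z) /\ g (n.+1%:R : Z) = (n.+1%:R : Z).
    by apply/permP=> x; rewrite perm1; have [] := gn x; rewrite natr_Zp.
  elim: n => [//|n [IH0 IH1]]; split=> //.
  have : inc (g (n.+1%:R : Z)) (g (n.+2%:R : Z)).
    by rewrite gi /= /polygon_inc [n.+2%:R]mulrSr eqxx orbT.
  rewrite IH1; case/or3P=> /eqP.
  + by move=> e; apply: (@perm_inj _ g); rewrite e.
  + by move->; rewrite -mulrSr.
  + by rewrite mulrSr => /addIr e; apply: (@perm_inj _ g); rewrite -e.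
Qed.

(** The base chamber is [[set 0; 1]].  The reflections that fix one of its
    elements are [x |-> 2 - x], which moves the even element 0, and
    [x |-> - x], which moves the odd element 1; their product is the rotation
    by [-2], of order [k] modulo [2k]. *)
Lemma realizable_polygon (D : coxeter_graph I) :
  cox_adj D a b -> cox_label D a b = Some k -> realizable D [set a; b].
Proof.
move=> adj_ab label_ab; have two_even : ~~ odd (1 + 1 : Z)%R by rewrite odd_add odd1.
have two_neq0 : (1 + 1 : Z) != 0.
  rewrite -[1 + 1]/(2%:R) natr_eq0 gtnNdvd // -[2%N]/(1.*2)%N ltn_double.
  exact: ltnW.
have ba : b != a by rewrite eq_sym.
have order_rot (c : Z) : c = 1 + 1 \/ c = - (1 + 1) -> #[rotation c]%g = k.
  move=> c2; have powE n x : (rotation c ^+ n)%g (x : Z) = x + c *+ n.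
    elim: n x => [|n IHn] x; first by rewrite perm1 addr0.
    by rewrite expgSr permM IHn rotationE mulrSr addrA.
  have c_eq0 n : (c *+ n == 0) = (k %| n)%N.
    have -> : (c *+ n == 0) = ((1 + 1 : Z) *+ n == 0).
      by case: c2 => ->; rewrite // mulNrn oppr_eq0.
    rewrite -mulr2n -mulrnA natr_eq0 mul2n -!muln2 dvdn_pmul2r //.
  have pow_eq1 n : ((rotation c ^+ n)%g == 1%g) = (k %| n)%N.
    rewrite -c_eq0; apply/eqP/eqP=> [E|E].
      by have := powE n 0; rewrite E perm1 add0r.
    by apply/permP=> x; rewrite powE E perm1 addr0.
  by apply/eqP; rewrite eqn_dvd order_dvdn pow_eq1 dvdnn -pow_eq1 expg_order eqxx.
exists polygon, (side 0), (fun i => reflection (if i == a then 1 + 1 else 0)).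
split; first exact: polygon_regular.
split=> [i|i j].
  case/set2P=> ->; rewrite ?eqxx ?(negPf ba); split.
  - exact: reflection_aut.
  - apply/eqP => /permP/(_ (0 : Z)); rewrite reflectionE subr0 perm1.
    by apply/eqP.
  - move=> x /set2P[] ->; rewrite reflectionE /= /polygon_typ ?add0r ?odd1 ?addrK //.
    by rewrite eqxx.
  - exact: reflection_aut.
  - apply/eqP => /permP/(_ (1 : Z)); rewrite reflectionE sub0r perm1 => /esym/eqP.
    by rewrite -addr_eq0 (negPf two_neq0).
  - move=> x /set2P[] ->; rewrite reflectionE /= /polygon_typ ?subr0 //.
    by rewrite add0r odd1 eqxx.
move=> /set2P[] -> /set2P[] ->; rewrite ?eqxx // ?(negPf ba) reflectionM => _.
  by rewrite adj_ab label_ab order_rot // sub0r; right.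
rewrite cox_adj_sym adj_ab -(cox_label_sym adj_ab) label_ab order_rot //.
by rewrite subr0; left.
Qed.

End Polygon.

(** * Growing the tree *)

Section TreeGrowth.

Variables (I : finType) (D : coxeter_graph I) (D_tree : is_tree D).
Implicit Types (S : {set I}) (i j u : I).

Definition connected_in S : Prop :=
  {in S &, forall i j,
    connect [rel x y | [&& x \in S, y \in S & cox_adj D x y]] i j}.

Lemma connected_in_grow S u j : j \in S -> cox_adj D u j ->
  connected_in S -> connected_in (u |: S).
Proof.
move=> Sj uj conS; rewrite /connected_in; set e := [rel _ _ | _].
have e_sym : connect_sym e.
  by apply: sym_connect_sym => x y; rewrite /e /= cox_adj_sym andbCA.
have SU : {in S &, forall i i', connect e i i'}.
  move=> i i' Si Si'; apply: connect_sub (conS i i' Si Si') => x y.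
  case/and3P=> Sx Sy xy; apply: connect1.
  by rewrite /e /= !in_setU1 Sx Sy xy !orbT.
have uS i : i \in S -> connect e u i.
  move=> Si; apply: connect_trans (SU j i Sj Si); apply: connect1.
  by rewrite /e /= !in_setU1 eqxx Sj uj orbT.
move=> x y /setU1P[->|Sx] /setU1P[->|Sy].
- exact: connect0.
- exact: uS.
- by rewrite e_sym uS.
- exact: SU.
Qed.

(** Two neighbours of [u] in [S] and a path joining them inside [S] would form
    a cycle of length at least 3 through [u]. *)
Lemma unique_neighbour S u i j : connected_in S -> u \notin S ->
  i \in S -> j \in S -> cox_adj D u i -> cox_adj D u j -> i = j.
Proof.
move=> conS Su Si Sj ui uj; have [_ _ acyclic] := D_tree.
have /connectP[p0 ep0 jp0] := conS i j Si Sj.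
case/shortenP: ep0 jp0 => p ep Up _ jp.
have pS : {subset i :: p <= S}.
  elim: p i Si ep {Up jp ui} => [|y p IHp] i Si /=.
    by move=> _ x; rewrite inE => /eqP->.
  case/andP=> /and3P[_ Sy _] /(IHp y Sy) sp x; rewrite inE => /orP[/eqP->//|].
  exact: sp.
have cyc : path.cycle (cox_adj D) (u :: i :: p).
  rewrite /= ui rcons_path -jp cox_adj_sym uj andbT.
  by apply: sub_path ep => x y /and3P[].
have : size (u :: i :: p) < 3.
  apply: acyclic cyc _; rewrite cons_uniq Up andbT.
  by apply: contra Su; apply: pS.
by case: p {ep Up pS cyc} jp => //= ->.
Qed.

Lemma exists_outer_neighbour S i : i \in S -> S != [set: I] ->
  exists u j, [/\ u \notin S, j \in S & cox_adj D u j].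
Proof.
move=> Si nST; have [_ conD _] := D_tree.
have [/existsP[u /existsP[j /and3P[]]]|/existsPn no_edge] :=
  boolP [exists u, [exists j, [&& u \notin S, j \in S & cox_adj D u j]]].
  by exists u, j.
have clS : closed (cox_adj D) [in S].
  apply: intro_closed; first by apply: sym_connect_sym; apply: cox_adj_sym.
  move=> x y xy Sx; apply/negPn/negP => Sy.
  have /existsPn/(_ x) := no_edge y.
  by rewrite Sy cox_adj_sym xy; move: Sx => /= ->.
case/eqP: nST; apply/setP=> x; rewrite in_setT.
by rewrite -(closed_connect clS (conD i x)).
Qed.

Lemma realizable_tree S0 i0 : i0 \in S0 -> connected_in S0 ->
  (forall u j, u \notin S0 -> cox_adj D u j -> cox_label D u j = Some 4) ->
  realizable D S0 -> realizable D [set: I].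
Proof.
move=> S0i conS0 label4 realS0.
suff grow n S : #|~: S| = n -> S0 \subset S -> connected_in S ->
    realizable D S -> realizable D [set: I].
  exact: (grow _ S0 erefl).
elim: n S => [|n IHn] S cS sS conS realS.
  move/eqP: cS; rewrite cards_eq0 => /eqP cS.
  by rewrite -setC0 -cS setCK.
have Si : i0 \in S := subsetP sS _ S0i.
have nST : S != [set: I] by apply: contraTneq isT => eS; rewrite eS setCT cards0 in cS.
have [u [j [Su Sj uj]]] := exists_outer_neighbour Si nST.
apply: (IHn (u |: S)).
- apply/eqP; rewrite -eqSS -cS (cardsD1 u (~: S)) in_setC Su add1n eqSS.
  by apply/eqP; congr #|pred_of_set _|; apply/setP=> x; rewrite !inE negb_or.
- exact: subset_trans sS (subsetUr _ _).
- exact: connected_in_grow uj conS.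
apply: (realizable_leaf Su Sj uj) => //.
  by apply: label4 => //; apply: contra Su; apply: (subsetP sS).
by move=> i Si' ui; apply: (unique_neighbour conS Su).
Qed.

End TreeGrowth.

Theorem theorem3p9 (I : finType) (D : coxeter_graph I)
    (D_tree : is_tree D) (D_labels : labels_4_except_one D) :
  exists H : incidence_system I,
    regular_hypertope H /\ has_coxeter_diagram H D.
Proof.
apply: realizable_setT; case: D_labels => [all4|[a [b [k [adj_ab k3 label_ab other4]]]]].
  have [/card_gt0P[i _] _ _] := D_tree.
  apply: (realizable_tree D_tree (set11 i)); last exact: realizable_set1.
    by move=> x y /set1P-> /set1P->; apply: connect0.
  by move=> u j _; apply: all4.
have ab : a != b by apply: contraTneq adj_ab => ->; rewrite cox_adj_irr.
apply: (realizable_tree D_tree (set21 a b)).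
- by move=> x y /set2P[]-> /set2P[]->; rewrite ?connect0 //; apply: connect1;
    rewrite /= !inE !eqxx ?orbT //= cox_adj_sym.
- move=> u j uab uj; apply: other4 => //.
  by apply: contraNneq uab => <-; apply: set21.
exact: (realizable_polygon ab k3).
Qed.
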